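(* Let $(d_n)_{n\ge1}$ be a sequence of natural numbers $d_n>1$, let $P=\|p_{i,n}\|$ be a matrix satisfying properties $1^\circ$–$4^\circ$ of the context, and let $\tilde F$ be the function on $[0;1]$ defined in the context. Then $\tilde F$ is Lebesgue integrable on $[0;1]$, and $$\int_0^1\tilde F(x)\,dx=\sum_{n=1}^\infty\frac{\tilde\beta_{0,n}+\tilde\beta_{1,n}+\tilde\beta_{2,n}+\dots+\tilde\beta_{d_n-1,n}}{d_1d_2\cdots d_n}.$$
   Context: Fix a sequence $(d_n)_{n\ge1}$ of natural numbers $d_n>1$; put $A_{d_n}=\{0,1,\dots,d_n-1\}$. Every $x\in[0;1]$ can be written as $$x=\Delta^{-(d_n)}_{\varepsilon_1\varepsilon_2\dots\varepsilon_n\dots}:=\sum_{n=1}^\infty\frac{1+\varepsilon_n}{d_1d_2\cdots d_n}(-1)^{n+1},\qquad \varepsilon_n=\varepsilon_n(x)\in A_{d_n}$$ (the nega-$(d_n)$-representation of $x$). $P=\|p_{i,n}\|$ ($n=1,2,\dots$; $i=0,1,\dots,d_n-1$) is a real matrix with the properties: $1^\circ$. $p_{i,n}\in(-1;1)$ for all $n\in\mathbb N$ and all $i$; $2^\circ$. $\sum_{i=0}^{d_n-1}p_{i,n}=1$ for all $n\in\mathbb N$; $3^\circ$. $\prod_{n=1}^\infty|p_{i_n,n}|=0$ for every sequence $(i_n)$ with $i_n\in A_{d_n}$; $4^\circ$. $\sum_{i=0}^{i_n-1}p_{i,n}>0$ for all $n$ and all $i_n\in A_{d_n}\setminus\{0\}$.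 Put $\beta_{0,n}=0$ and $\beta_{\varepsilon,n}=\sum_{i=0}^{\varepsilon-1}p_{i,n}$ for $\varepsilon\in A_{d_n}\setminus\{0\}$. For $\varepsilon\in A_{d_n}$ put $\tilde\beta_{\varepsilon,n}=\beta_{\varepsilon,n}$, $\tilde p_{\varepsilon,n}=p_{\varepsilon,n}$ if $n$ is odd, and $\tilde\beta_{\varepsilon,n}=\beta_{d_n-1-\varepsilon,n}$, $\tilde p_{\varepsilon,n}=p_{d_n-1-\varepsilon,n}$ if $n$ is even. The function $\tilde F$ on $[0;1]$ is defined, for $x=\Delta^{-(d_n)}_{\varepsilon_1\varepsilon_2\dots\varepsilon_n\dots}$, by $$\tilde F(x)=\beta_{\varepsilon_1(x),1}+\sum_{n=2}^\infty\left(\tilde\beta_{\varepsilon_n(x),n}\prod_{j=1}^{n-1}\tilde p_{\varepsilon_j(x),j}\right).$$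
   Formalization: The formal theorem additionally assumes that the series defining F̃ converges at every x in [0;1] along each of its nega-representations; properties 1°–4° do not guarantee this, and without it F̃ may be undefined. *)

(* Defs.v *)
From mathcomp Require Import all_boot all_order all_algebra.
From mathcomp Require Import all_classical all_reals all_analysis.
Import Order.TTheory GRing.Theory Num.Theory.
Import numFieldNormedType.Exports.

Set Implicit Arguments.
Unset Strict Implicit.
Unset Printing Implicit Defensive.

Local Open Scope classical_set_scope.
Local Open Scope ring_scope.

(* All sequences are indexed from 1: the values [d 0], [eps 0] and [p i 0] are
   never used, and neither is [p i n] for [d n <= i].  The first index of [p]
   is the row (the digit), the second one the column (the rank). *)

Section NegaCantor.
Variable R : realType.
Implicit Types (d eps : nat -> nat) (p : nat -> nat -> R) (x : R).

Definition digit_seq d eps : Prop := forall n, (0 < n)%N -> (eps n < d n)%N.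

Definition nega_psum d eps (N : nat) : R :=
  \sum_(1 <= n < N.+1)
    (1 + (eps n)%:R) / (\prod_(1 <= j < n.+1) d j)%:R * (-1) ^+ n.+1.

Definition nega_rep d eps x : Prop :=
  digit_seq d eps /\ nega_psum d eps @ \oo --> x.

Definition matrix_P d p : Prop :=
  [/\ forall n i, (0 < n)%N -> (i < d n)%N -> -1 < p i n < 1,
      forall n, (0 < n)%N -> \sum_(0 <= i < d n) p i n = 1,
      forall eps, digit_seq d eps ->
        (\prod_(1 <= n < N.+1) `|p (eps n) n|) @[N --> \oo] --> (0 : R) &
      forall n k, (0 < n)%N -> (0 < k < d n)%N -> 0 < \sum_(0 <= i < k) p i n].

(* [beta p 0 n] is the empty sum. *)
Definition beta p (e n : nat) : R := \sum_(0 <= i < e) p i n.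

Definition tbeta d p (e n : nat) : R :=
  if odd n then beta p e n else beta p (d n - 1 - e)%N n.

Definition tp d p (e n : nat) : R :=
  if odd n then p e n else p (d n - 1 - e)%N n.

Definition Ftilde_psum d p eps (N : nat) : R :=
  beta p (eps 1%N) 1 +
  \sum_(2 <= n < N.+1)
    tbeta d p (eps n) n * \prod_(1 <= j < n) tp d p (eps j) j.

(* The value is the sum of the series along a nega-(d_n)-representation of x.
   Under [matrix_P], when x has two representations the series converges along
   both of them, to the same sum: they correspond, after reversing the digits
   of even rank, to the two Cantor expansions ...c000... and
   ...(c-1)(d-1)(d-1)(d-1)... of x.  The default 0 is taken only if x has no
   representation (x outside [0, 1]) or the series diverges. *)
Definition Ftilde d p x : R :=
  xget 0 [set y | exists2 eps, nega_rep d eps x & Ftilde_psum d p eps @ \oo --> y].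

End NegaCantor.

(* Main.v *)
Require Import Defs.
From mathcomp Require Import all_boot all_order all_algebra.
From mathcomp Require Import all_classical all_reals all_analysis.
From mathcomp Require Import measurable_realfun ring lra zify.
Import Order.TTheory GRing.Theory Num.Theory.
Import numFieldNormedType.Exports.

Local Open Scope classical_set_scope.
Local Open Scope ring_scope.

(** Reversing the digits of even rank turns a nega-representation of [x] into
    its Cantor expansion with digits [a_1, a_2, ...], and turns the series for
    the function into
    [sum_n beta (a_n) n * prod_(j < n) p (a_j) j] ([nega_repP],
    [Ftilde_psum_flip]).  The [N]-th partial sum of this series is a step
    function, constant on the [d_1 ... d_N] cylinders of rank [N], that is, on
    the half-open intervals of length [1 / (d_1 ... d_N)] that tile the unit
    interval without its right end.  The weight of a cylinder is the product of
    the [p] of its digits.  Since the weights of the cylinders of a given rank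
    sum to [1], the integral of the [N]-th step function is the [N]-th partial
    sum of the announced series ([mean_word_sum], [integral_step]).  It remains
    to pass to the limit by dominated convergence, which needs two facts.

    The step functions converge to the function at every point [x < 1]
    ([word_sum_cvg]).  A point may have two representations, and the definition
    picks one of them; but the two label, at each rank, equal or adjacent
    cylinders.  Passing from a cylinder to the next one adds to the partial sum
    exactly the weight of the cylinder ([word_sum_succ]), and the weights along
    a digit sequence tend to [0].

    The step functions are uniformly bounded ([digsum_uniformly_bounded]).
    This is not clear from the shape of the series, because the weights may be
    negative and the [beta] arbitrarily large.  It follows from convergence at
    every point: by self-similarity, partial sums that are unbounded are
    unbounded inside every cylinder of nonzero weight, and nesting such
    cylinders produces a point at which the series diverges
    ([unbounded_extension], [digsum_bounded_nonstop]).
*)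

(** * Series indexed by digit sequences *)

Section DigitSeries.
Set Implicit Arguments.
Unset Strict Implicit.
Unset Printing Implicit Defensive.

Variables (R : realType) (d : nat -> nat) (b q : nat -> nat -> R).
Implicit Types (a w : nat -> nat) (n N : nat).

Definition digprod a N : R := \prod_(1 <= j < N.+1) q (a j) j.

Definition digsum a N : R :=
  \sum_(1 <= n < N.+1) b (a n) n * \prod_(1 <= j < n) q (a j) j.

Lemma digprod0 a : digprod a 0 = 1.
Proof. by rewrite /digprod big_geq. Qed.

Lemma digprodS a N : digprod a N.+1 = digprod a N * q (a N.+1) N.+1.
Proof. by rewrite /digprod big_nat_recr. Qed.

Lemma digsum0 a : digsum a 0 = 0.
Proof. by rewrite /digsum big_geq. Qed.

Lemma digsumS a N : digsum a N.+1 = digsum a N + b (a N.+1) N.+1 * digprod a N.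
Proof. by rewrite /digsum big_nat_recr. Qed.

Lemma eq_digprod a w N :
  (forall j, (0 < j <= N)%N -> a j = w j) -> digprod a N = digprod w N.
Proof.
by move=> aw; apply: eq_big_nat => j /andP[j0 jN]; rewrite aw// j0 -ltnS.
Qed.

Lemma eq_digsum a w N :
  (forall j, (0 < j <= N)%N -> a j = w j) -> digsum a N = digsum w N.
Proof.
elim: N => [|N IH] aw; first by rewrite !digsum0.
have aw' j : (0 < j <= N)%N -> a j = w j.
  by move=> /andP[j0 jN]; rewrite aw// j0 (leq_trans jN).
by rewrite !digsumS (IH aw') (@eq_digprod a w)// aw//= leqnn.
Qed.

Definition splice w a n j := if (j <= n)%N then w j else a j.

Lemma splice_le w a n j : (j <= n)%N -> splice w a n j = w j.
Proof. by rewrite /splice => ->. Qed.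

(** Divided by the product up to rank [n], the tail after rank [n] depends only
    on the digits after rank [n]; both identities are cleared of these
    denominators. *)
Lemma digsum_splice w a n N : (n <= N)%N ->
  (digsum (splice w a n) N - digsum w n) * digprod a n =
    (digsum a N - digsum a n) * digprod w n /\
  digprod (splice w a n) N * digprod a n = digprod a N * digprod w n.
Proof.
move=> nN; rewrite -(subnKC nN); elim: (N - n)%N => [|m [IHs IHp]].
  rewrite addn0 (@eq_digsum (splice w a n) w) ?(@eq_digprod (splice w a n) w).
  - by rewrite !subrr !mul0r mulrC.
  - by move=> j /andP[_]; exact: splice_le.
  - by move=> j /andP[_]; exact: splice_le.
have sp : splice w a n (n + m).+1 = a (n + m).+1.
  by rewrite /splice ifF//; lia.
rewrite addnS !digsumS !digprodS sp; split.
  by rewrite addrAC mulrDl IHs -mulrA IHp; ring.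
by rewrite mulrAC IHp; ring.
Qed.

Hypothesis q_le1 : forall n e, (0 < n)%N -> (e < d n)%N -> `|q e n| <= 1.

Lemma digprod_le1 a N : digit_seq d a -> `|digprod a N| <= 1.
Proof.
move=> da; elim: N => [|N IH]; first by rewrite digprod0 normr1.
by rewrite digprodS normrM mulr_ile1// q_le1// da.
Qed.

Lemma digsum_bounded_at n : exists C, 0 <= C /\
  forall a N, digit_seq d a -> (N <= n)%N -> `|digsum a N| <= C.
Proof.
elim: n => [|n [C [C0 IH]]].
  exists 0; split=> // a N _; rewrite leqn0 => /eqP ->.
  by rewrite digsum0 normr0.
pose B := \sum_(e < d n.+1) `|b e n.+1|.
have B0 : 0 <= B by apply: sumr_ge0.
exists (C + B); split; first exact: addr_ge0.
move=> a N da; rewrite leq_eqVlt => /orP[/eqP ->|Nn]; last first.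
  by apply: le_trans (IH a N da Nn) _; rewrite lerDl.
rewrite digsumS (le_trans (ler_normD _ _))// lerD ?IH// normrM.
have le1 := digprod_le1 n da; apply: (@le_trans _ _ `|b (a n.+1) n.+1|).
  by rewrite ler_piMr.
rewrite /B (bigD1 (Ordinal (da n.+1 isT)))//= lerDl.
exact: sumr_ge0.
Qed.

(** A digit of zero weight stops the series. *)
Definition nonstop a := digit_seq d a /\ forall n, (0 < n)%N -> q (a n) n != 0.

Lemma digprod_neq0 a N : nonstop a -> digprod a N != 0.
Proof.
move=> [_ qa]; elim: N => [|N IH]; first by rewrite digprod0 oner_eq0.
by rewrite digprodS mulf_neq0// qa.
Qed.

Lemma nonstop_splice w a n : nonstop w -> nonstop a -> nonstop (splice w a n).
Proof.
move=> [dw qw] [da qa]; split=> j j0; rewrite /splice; case: ifP => _.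
all: by [exact: dw|exact: da|exact: qw|exact: qa].
Qed.

(** If the partial sums are unbounded, they are unbounded among the sequences
    that begin with any given word of nonzero product: only the first [n]
    terms and a nonzero factor depend on the word. *)
Lemma unbounded_extension :
  (forall K, exists a N, nonstop a /\ K < `|digsum a N|) ->
  forall w n K, nonstop w -> exists a N,
    [/\ nonstop a, (forall j, (j <= n)%N -> a j = w j), (n < N)%N &
        K < `|digsum a N|].
Proof.
move=> unb w n K Ew; have [C [C0 bndC]] := digsum_bounded_at n.
have pw0 : 0 < `|digprod w n| by rewrite normr_gt0 digprod_neq0.
have [a [N [Ea big]]] := unb (C + C + (C + `|K|) / `|digprod w n|).
have Nn : (n < N)%N.
  rewrite ltnNge; apply/negP => /(bndC a N Ea.1); rewrite leNgt => /negP; apply.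
  apply: le_lt_trans big; rewrite -addrA lerDl addr_ge0// divr_ge0// addr_ge0//.
exists (splice w a n), N; split=> //.
- exact: nonstop_splice.
- by move=> j; exact: splice_le.
have [/(congr1 Num.norm) es _] := digsum_splice w a (ltnW Nn).
rewrite !normrM in es.
have la := bndC a n Ea.1 (leqnn n); have lw := bndC w n Ew.1 (leqnn n).
have lp := digprod_le1 n Ea.1.
have l1 : (C + `|K|) / `|digprod w n| < `|digsum a N - digsum a n|.
  by have := lerB_dist (digsum a N) (digsum a n); lra.
have l2 : C + `|K| < `|digsum (splice w a n) N - digsum w n|.
  rewrite ltr_pdivrMr// -es in l1; apply: lt_le_trans l1 _.
  by rewrite ler_piMr.
have := ler_normB (digsum (splice w a n) N) (digsum w n).
by have := ler_norm K; lra.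
Qed.

(** Baire category, made explicit: if the partial sums were unbounded, longer
    and longer words with larger and larger partial sums could be nested, and
    the series would diverge along the limit sequence. *)
Lemma digsum_bounded_nonstop :
  (forall a, digit_seq d a -> cvgn (digsum a)) ->
  exists K, forall a N, nonstop a -> `|digsum a N| <= K.
Proof.
move=> cv; apply: contrapT => nbd.
have unb K : exists a N, nonstop a /\ K < `|digsum a N|.
  apply: contrapT => h; apply: nbd; exists K => a N Ea; rewrite leNgt.
  by apply/negP => hK; apply: h; exists a, N.
have [a0 [_ [Ea0 _]]] := unb 0.
(* A state [(w, n)] stands for the word of the first [n] digits of [w]. *)
pose T := {s : (nat -> nat) * nat | nonstop s.1}.
pose step (s t : T) := [/\ forall j, (j <= (sval s).2)%N ->
    (sval t).1 j = (sval s).1 j, ((sval s).2 < (sval t).2)%N &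
    (sval s).2%:R < `|digsum (sval t).1 (sval t).2| ].
have ex (s : T) : {t : T | step s t}.
  apply: cid; case: s => -[w n] /= Ew.
  have [a [N [Ea aw nN big]]] := unbounded_extension unb n n%:R Ew.
  by exists (exist _ (a, N) Ea).
have [f [f0 fS]] := dependent_choice ex (exist _ (a0, 0%N) Ea0).
pose W k := (sval (f k)).1; pose L k := (sval (f k)).2.
have L_ge k : (k <= L k)%N.
  elim: k => [//|k IH]; have [_ lt _] := fS k; exact: leq_ltn_trans IH lt.
have stable k m j : (j <= L k)%N -> W (k + m)%N j = W k j.
  move=> jk; elim: m => [|m IH]; first by rewrite addn0.
  have [eqW _ _] := fS (k + m)%N; rewrite addnS -IH; apply: eqW.
  apply: leq_trans jk _; rewrite -/(L (k + m)%N) {IH}.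
  elim: m => [|m IH]; first by rewrite addn0.
  by apply: leq_trans IH _; rewrite addnS; have [_ /ltnW ? _] := fS (k + m)%N.
(* The diagonal is the limit, since [W k] is already final up to rank [L k]. *)
pose e j := W j j.
have eW k j : (j <= L k)%N -> e j = W k j.
  move=> jk; rewrite /e; case: (leqP j k) => h.
    by rewrite -(subnKC h) stable.
  by rewrite -{1}(subnKC (ltnW h)) stable.
have de : digit_seq d e by move=> j j0; exact: (svalP (f j)).1.
have /cvg_seq_bounded := cv e de.
move=> [M [_ /(_ (M + 1))]]; rewrite ltrDl => /(_ ltr01) bd.
have [k Mk] : exists k, M + 1 < k%:R.
  by exists (Num.trunc (M + 1)).+1; exact: truncnS_gt.
have [_ _ big] := fS k; have /= := bd (L k.+1) I.
rewrite leNgt => /negP; apply.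
rewrite (@eq_digsum e (W k.+1)); last by move=> j /andP[_]; exact: eW.
apply: le_lt_trans big; apply: le_trans (ltW Mk) _.
by rewrite ler_nat; exact: L_ge.
Qed.

(** Replacing the first digit of zero weight by a digit of nonzero weight with
    a nearby [b] changes the sum at that rank by at most [1], and the later
    terms of the original series vanish; so it suffices to bound the sums along
    sequences that never stop. *)
Lemma digsum_bounded :
  (forall n e, (0 < n)%N -> (e < d n)%N ->
    exists e', [/\ (e' < d n)%N, q e' n != 0 & `|b e n - b e' n| <= 1]) ->
  (forall a, digit_seq d a -> cvgn (digsum a)) ->
  exists K, forall a N, digit_seq d a -> `|digsum a N| <= K.
Proof.
move=> near_digit cv; have [K bdK] := digsum_bounded_nonstop cv.
exists (K + 1) => a N da.
(* [w] replaces the digits of zero weight and keeps the others. *)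
pose good n e' := [/\ (e' < d n)%N, q e' n != 0, `|b (a n) n - b e' n| <= 1 &
  (q (a n) n != 0 -> e' = a n)].
have [w Hw] : exists w, forall n, (0 < n)%N -> good n (w n).
  suff /choice[w Hw] : forall n, exists e', (0 < n)%N -> good n e' by exists w.
  move=> n; case: (posnP n) => [->|n0]; first by exists 0%N.
  have [qa|qa] := eqVneq (q (a n) n) 0.
    have [e' [? ? ?]] := near_digit n (a n) n0 (da n n0).
    by exists e'; split=> //; rewrite qa eqxx.
  by exists (a n); split=> //; [exact: da|rewrite subrr normr0].
have Ew : nonstop w by split=> n /Hw[].
(* Either no digit of zero weight has occurred up to rank [N], or the partial
   sum of [a] is frozen and was compared with that of [w] at the rank where
   the first one occurred. *)
suff : (digsum a N = digsum w N /\ digprod a N = digprod w N) \/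
    (digprod a N = 0 /\ exists M, `|digsum a N - digsum w M| <= 1).
  case=> [[-> _]|[_ [M le1]]].
    by apply: le_trans (bdK w N Ew) _; rewrite lerDl.
  have -> : digsum a N = digsum w M + (digsum a N - digsum w M) by ring.
  by rewrite (le_trans (ler_normD _ _))// lerD// bdK.
elim: N => [|N]; first by left; rewrite !digsum0 !digprod0.
have [wd wq wb wa] := Hw N.+1 isT.
rewrite !digsumS !digprodS => -[[-> eqP]|[p0 [M le1]]]; last first.
  by right; rewrite p0 mul0r mulr0 addr0; split=> //; exists M.
have [q0|/wa ->] := eqVneq (q (a N.+1) N.+1) 0; last by left; rewrite eqP.
right; rewrite q0 mulr0; split=> //; exists N.+1.
rewrite digsumS eqP opprD addrACA subrr add0r -mulrBl normrM.
by rewrite mulr_ile1// digprod_le1//; case: Ew.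
Qed.

End DigitSeries.

(** * Partial sums as functions of the index of a cylinder *)

Section Words.
Set Implicit Arguments.
Unset Strict Implicit.
Unset Printing Implicit Defensive.
Variables (R : realType) (d : nat -> nat) (p : nat -> nat -> R).
Hypothesis d_gt1 : forall n, (0 < n)%N -> (1 < d n)%N.
Implicit Types (a eps : nat -> nat) (n N k : nat) (x : R).

Definition denom N : nat := (\prod_(1 <= j < N.+1) d j)%N.

Lemma denom0 : denom 0 = 1%N.
Proof. by rewrite /denom big_geq. Qed.

Lemma denomS N : denom N.+1 = (denom N * d N.+1)%N.
Proof. by rewrite /denom big_nat_recr. Qed.

Lemma d_gt0 n : (0 < d n.+1)%N.
Proof. exact: ltnW (d_gt1 (ltn0Sn n)). Qed.

Lemma denom_gt N : (N < denom N)%N.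
Proof.
elim: N => [|N IH]; first by rewrite denom0.
by rewrite denomS; have := d_gt1 (ltn0Sn N); nia.
Qed.

Lemma denom_gt0 N : (0 < denom N)%N.
Proof. exact: leq_ltn_trans (leq0n N) (denom_gt N). Qed.

Lemma denomR_gt0 N : 0 < (denom N)%:R :> R.
Proof. by rewrite ltr0n denom_gt0. Qed.

Lemma denomR_neq0 N : (denom N)%:R != 0 :> R.
Proof. by rewrite gt_eqF ?denomR_gt0. Qed.

Lemma inv_denom_cvg0 : ((denom N)%:R^-1 : R) @[N --> \oo] --> (0 : R).
Proof.
apply: (@squeeze_cvgr _ _ _ _ (fun=> 0) (@harmonic R)).
- apply: nearW => N; rewrite invr_ge0 ler0n/= lef_pV2 ?posrE ?denomR_gt0//.
  by rewrite ler_nat denom_gt.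
- exact: cvg_cst.
- exact: cvg_harmonic.
Qed.

(** The cylinders of rank [N] are numbered from left to right. *)
Fixpoint cantor_num a N : nat :=
  if N is M.+1 then (cantor_num a M * d N + a N)%N else 0%N.

Lemma cantor_numS a N :
  cantor_num a N.+1 = (cantor_num a N * d N.+1 + a N.+1)%N.
Proof. by []. Qed.

(** [word_prod N k] and [word_sum N k] are the product and the partial sum of
    the series along the [k]-th word of length [N]; division by [d N] removes
    the last digit of a word. *)
Fixpoint word_prod N k : R :=
  if N is M.+1 then word_prod M (k %/ d N) * p (k %% d N)%N N else 1.

Fixpoint word_sum N k : R :=
  if N is M.+1
  then word_sum M (k %/ d N) + beta p (k %% d N)%N N * word_prod M (k %/ d N)
  else 0.

Lemma word_cantor_num a N : digit_seq d a ->
  word_prod N (cantor_num a N) = digprod p a N /\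
  word_sum N (cantor_num a N) = digsum (beta p) p a N.
Proof.
move=> da; elim: N => [|N [IHp IHs]]; first by rewrite digprod0 digsum0.
have aN := da N.+1 isT.
rewrite /= divnMDl ?d_gt0// (divn_small aN) addn0 modnMDl (modn_small aN).
by rewrite IHp IHs digprodS digsumS.
Qed.

Lemma betaS e n : beta p e.+1 n = beta p e n + p e n.
Proof. by rewrite /beta big_nat_recr. Qed.

Lemma beta0 n : beta p 0 n = 0.
Proof. by rewrite /beta big_geq. Qed.

Hypothesis p_sum1 : forall n, (0 < n)%N -> \sum_(0 <= i < d n) p i n = 1.

Lemma beta_d n : beta p (d n.+1) n.+1 = 1.
Proof. exact: p_sum1. Qed.

(** The value at the left end of a cylinder plus the weight of the cylinder is
    the value at its right end, where the next cylinder of the same rank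
    begins. *)
Lemma word_sum_succ N k : (k.+1 < denom N)%N ->
  word_sum N k.+1 = word_sum N k + word_prod N k.
Proof.
elim: N k => [|N IH] k; first by rewrite denom0.
rewrite denomS /=; set m := d N.+1 => km.
have m0 : (0 < m)%N := d_gt0 N.
have := ltn_pmod k m0; rewrite leq_eqVlt => /orP[/eqP last_digit|lt_m].
  have kS : k.+1 = ((k %/ m).+1 * m + 0)%N.
    by rewrite {1}(divn_eq k m) -addnS last_digit addn0 mulSn addnC.
  have kN : ((k %/ m).+1 < denom N)%N.
    by rewrite -(ltn_pmul2r m0) -[X in (X < _)%N]addn0 -kS.
  rewrite kS divnMDl// div0n addn0 modnMDl mod0n beta0 mul0r addr0 IH//.
  rewrite -addrA; congr (_ + _).
  have last_weight : beta p (k %% m) N.+1 + p (k %% m)%N N.+1 = 1.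
    by rewrite -betaS last_digit beta_d.
  by rewrite [X in _ + X]mulrC -mulrDl last_weight mul1r.
have kS : k.+1 = ((k %/ m) * m + (k %% m).+1)%N by rewrite addnS -divn_eq.
rewrite {1 2 3}kS divnMDl// modnMDl (divn_small lt_m) addn0 (modn_small lt_m).
by rewrite betaS mulrDl addrA; congr (_ + _); rewrite mulrC.
Qed.

Lemma sum_divmod (m n : nat) (f : nat -> nat -> R) : (0 < m)%N ->
  \sum_(0 <= k < n * m) f (k %/ m)%N (k %% m)%N =
    \sum_(0 <= i < n) \sum_(0 <= j < m) f i j.
Proof.
move=> m0; elim: n => [|n IH]; first by rewrite mul0n !big_geq.
rewrite big_nat_recr//= -IH mulSn addnC.
rewrite (@big_cat_nat _ _ _ (n * m)%N) ?leq_addr//=; congr (_ + _).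
rewrite -{1}[(n * m)%N]add0n big_addn addnC addnK.
apply: eq_big_nat => j jm; rewrite addnC divnMDl// modnMDl.
by rewrite divn_small// addn0 modn_small.
Qed.

Lemma sum_word_prod N : \sum_(0 <= k < denom N) word_prod N k = 1.
Proof.
elim: N => [|N IH]; first by rewrite denom0 big_nat1.
rewrite denomS /= (sum_divmod _ (fun i j => word_prod N i * p j N.+1)) ?d_gt0//.
by under eq_bigr do rewrite -mulr_sumr p_sum1// mulr1.
Qed.

Lemma sum_word_sum N : \sum_(0 <= k < denom N.+1) word_sum N.+1 k =
  (d N.+1)%:R * \sum_(0 <= k < denom N) word_sum N k +
  \sum_(0 <= e < d N.+1) beta p e N.+1.
Proof.
rewrite denomS /=.
rewrite (sum_divmod _ (fun i j => word_sum N i + beta p j N.+1 * word_prod N i))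
  ?d_gt0//=.
under eq_bigr do rewrite big_split/= sumr_const_nat subn0 -mulr_suml.
by rewrite big_split/= sumrMnl mulr_natl -mulr_sumr sum_word_prod mulr1.
Qed.

Lemma sum_tbeta n : \sum_(0 <= e < d n.+1) tbeta d p e n.+1 =
  \sum_(0 <= e < d n.+1) beta p e n.+1.
Proof.
rewrite /tbeta; case: (odd n.+1) => //; rewrite [RHS]big_nat_rev/=.
by apply: eq_big_nat => e _; congr beta; lia.
Qed.

(** Each new rank adds the mean of its [beta], divided by the number of
    cylinders of the previous rank, because the weights of these sum to [1]. *)
Lemma mean_word_sum N :
  (denom N)%:R^-1 * \sum_(0 <= k < denom N) word_sum N k =
  \sum_(1 <= n < N.+1)
     (\sum_(0 <= e < d n) tbeta d p e n) / (\prod_(1 <= j < n.+1) d j)%:R.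
Proof.
elim: N => [|N IH]; first by rewrite denom0 big_nat1 big_geq// mulr0.
rewrite big_nat_recr//= -IH sum_word_sum sum_tbeta -/(denom N.+1).
rewrite mulrDr [X in _ + X = _]mulrC; congr (_ + _).
by rewrite denomS natrM invfM mulrA mulfVK// pnatr_eq0 -lt0n d_gt0.
Qed.

(** The [beta] does not change across digits of zero weight, so the nearest
    digit of nonzero weight has a [beta] that differs by at most one weight. *)
Lemma near_nonzero_digit n e : (0 < n)%N -> (e < d n)%N ->
  (forall i, (i < d n)%N -> `|p i n| <= 1) ->
  exists e', [/\ (e' < d n)%N, p e' n != 0 & `|beta p e n - beta p e' n| <= 1].
Proof.
move=> n0 ed ple1.
have beta_const i j : (i <= j)%N ->
    (forall l, (i <= l < j)%N -> p l n = 0) -> beta p j n = beta p i n.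
  move=> ij z; rewrite /beta (big_cat_nat _ ij)//= [X in _ + X]big1_seq ?addr0//.
  by move=> l; rewrite mem_index_iota => /andP[_ /z].
have [i0 pi0 i0d] : exists2 i, p i n != 0 & (i < d n)%N.
  apply: contrapT => h; have := p_sum1 n0.
  rewrite big1_seq => [/esym/eqP|l]; first by rewrite oner_eq0.
  rewrite mem_index_iota => /andP[_ /andP[_ ld]]; apply/eqP.
  by apply: contrapT => /negP pl; apply: h; exists l.
(* Take the last digit of nonzero weight below [e] if there is one; otherwise
   both [beta] vanish at the first digit of nonzero weight. *)
have [ex_below|h] := pselect (exists l, (l < e)%N && (p l n != 0)).
  have below l : (l < e)%N && (p l n != 0) -> (l <= e)%N.
    by move=> /andP[/ltnW].
  have [i /andP[ie pi] imax] := ex_maxnP ex_below below.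
  exists i; split=> //; first exact: ltn_trans ie ed.
  rewrite (beta_const i.+1 e ie); last first.
    move=> j /andP[ij je]; apply/eqP; apply: contrapT => /negP pj.
    by have := imax j; rewrite je pj => /(_ isT); rewrite leqNgt ij.
  by rewrite betaS addrAC subrr add0r ple1// (ltn_trans ie ed).
have ex_nonzero : exists i, p i n != 0 by exists i0.
have [i pi imin] := ex_minnP ex_nonzero.
exists i; split=> //; first exact: leq_ltn_trans (imin _ pi0) i0d.
rewrite (beta_const 0%N e)// ?(beta_const 0%N i)// ?subrr ?normr0//.
- move=> j /andP[_ ji]; apply/eqP; apply: contrapT => /negP pj.
  by have := imin j pj; rewrite leqNgt ji.
- move=> j /andP[_ je]; apply/eqP; apply: contrapT => /negP pj.
  by apply: h; exists j; rewrite je.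
Qed.

End Words.

(** * Representations and nested cylinders *)

Section Expansions.
Set Implicit Arguments.
Unset Strict Implicit.
Unset Printing Implicit Defensive.
Variables (R : realType) (d : nat -> nat) (p : nat -> nat -> R).
Hypothesis d_gt1 : forall n, (0 < n)%N -> (1 < d n)%N.
Implicit Types (a eps : nat -> nat) (n N k : nat) (x : R).

Definition flip eps n : nat := if odd n then eps n else (d n - 1 - eps n)%N.

Lemma flip_digit_seq eps : digit_seq d eps -> digit_seq d (flip eps).
Proof.
move=> de n n0; rewrite /flip; case: ifP => _; first exact: de.
by have := d_gt1 n0; lia.
Qed.

Lemma flipK eps n : digit_seq d eps -> (0 < n)%N -> flip (flip eps) n = eps n.
Proof.
move=> de n0; have := de n n0; rewrite /flip; case: (odd n) => /=; lia.
Qed.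

Lemma Ftilde_psum_flip eps N :
  Ftilde_psum d p eps N.+1 = digsum (beta p) p (flip eps) N.+1.
Proof.
have tpE j : tp d p (eps j) j = p (flip eps j) j by rewrite /tp /flip; case: ifP.
have tbE j : tbeta d p (eps j) j = beta p (flip eps j) j.
  by rewrite /tbeta /flip; case: ifP.
rewrite /Ftilde_psum /digsum (@big_ltn _ _ _ 1)// big_geq// mulr1; congr (_ + _).
apply: eq_bigr => n _; rewrite tbE; congr (_ * _).
by apply: eq_bigr => j _; rewrite tpE.
Qed.

Lemma Ftilde_psum_cvg eps (l : R) :
  Ftilde_psum d p eps @ \oo --> l <-> digsum (beta p) p (flip eps) @ \oo --> l.
Proof.
rewrite -(cvg_shiftS (Ftilde_psum d p eps)) -(cvg_shiftS (digsum _ _ _)).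
by under eq_fun do rewrite Ftilde_psum_flip.
Qed.

(** Reversing the digits of even rank turns the alternating expansion into the
    Cantor expansion: the partial sums agree at even ranks. *)
Lemma nega_psum_cantor_num eps N : digit_seq d eps ->
  nega_psum R d eps N =
    ((cantor_num d (flip eps) N)%:R + (odd N)%:R) / (denom d N)%:R.
Proof.
move=> de; elim: N => [|N IH].
  by rewrite /nega_psum big_geq// addr0 mul0r.
rewrite /nega_psum big_nat_recr//= -/(nega_psum _ _ _ _) IH -/(denom d N.+1).
have D0 : (denom d N)%:R != 0 :> R by rewrite denomR_neq0.
have dN := d_gt1 (ltn0Sn N).
have d0 : (d N.+1)%:R != 0 :> R by rewrite pnatr_eq0 -lt0n ltnW.
rewrite denomS natrD !natrM /flip -signr_odd /=.
case: (odd N) => /=; last by rewrite expr0; field; rewrite d0 D0.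
rewrite expr1 -subnDA natrB ?natrD; last exact: (de N.+1 isT).
by field; rewrite d0 D0.
Qed.

Definition cell_left a N : R := (cantor_num d a N)%:R / (denom d N)%:R.
Definition cell_right a N : R := (cantor_num d a N).+1%:R / (denom d N)%:R.

Lemma cell_rightE a N : cell_right a N = cell_left a N + (denom d N)%:R^-1.
Proof. by rewrite /cell_right /cell_left -natr1 mulrDl mul1r. Qed.

Lemma cell_leftS a N :
  cell_left a N.+1 = cell_left a N + (a N.+1)%:R / (denom d N.+1)%:R.
Proof.
have D0 : (denom d N)%:R != 0 :> R by rewrite denomR_neq0.
have d0 : (d N.+1)%:R != 0 :> R by rewrite pnatr_eq0 -lt0n d_gt0.
rewrite /cell_left cantor_numS denomS natrD !natrM.
by field; rewrite d0 D0.
Qed.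

Lemma inv_denomS N :
  (denom d N)%:R^-1 = (d N.+1)%:R / (denom d N.+1)%:R :> R.
Proof.
have D0 : (denom d N)%:R != 0 :> R by rewrite denomR_neq0.
have d0 : (d N.+1)%:R != 0 :> R by rewrite pnatr_eq0 -lt0n d_gt0.
by rewrite denomS natrM; field; rewrite d0 D0.
Qed.

Lemma cell_left_nondecreasing a : nondecreasing_seq (cell_left a).
Proof.
by apply/nondecreasing_seqP => N; rewrite cell_leftS lerDl divr_ge0.
Qed.

Lemma cell_right_nonincreasing a :
  digit_seq d a -> nonincreasing_seq (cell_right a).
Proof.
move=> da; apply/nonincreasing_seqP => N.
rewrite !cell_rightE cell_leftS -addrA lerD2l.
rewrite (inv_denomS N) -{2}[(denom d N.+1)%:R^-1]mul1r -mulrDl.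
by rewrite ler_pM2r ?invr_gt0 ?denomR_gt0// natr1 ler_nat; exact: (da N.+1 isT).
Qed.

Lemma cell_left_le_right a M N :
  digit_seq d a -> cell_left a M <= cell_right a N.
Proof.
move=> da; apply: (@le_trans _ _ (cell_left a (maxn M N))).
  by apply: cell_left_nondecreasing; exact: leq_maxl.
apply: (@le_trans _ _ (cell_right a (maxn M N))).
  by rewrite cell_rightE lerDl invr_ge0.
by apply: cell_right_nonincreasing => //; exact: leq_maxr.
Qed.

(** A point is represented by the digits that label the nested cylinders
    containing it. *)
Lemma nega_repP eps x : digit_seq d eps ->
  nega_rep d eps x <->
  forall N, cell_left (flip eps) N <= x <= cell_right (flip eps) N.
Proof.
move=> de; have da := flip_digit_seq de; set a := flip eps in da *.
have psE N : nega_psum R d eps N = cell_left a N + (odd N)%:R / (denom d N)%:R.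
  by rewrite nega_psum_cantor_num// mulrDl.
have odd_le N : 0 <= ((odd N)%:R / (denom d N)%:R : R) <= (denom d N)%:R^-1.
  by case: (odd N); rewrite ?mul0r ?mul1r ?lexx invr_ge0 ler0n.
have ps_in M N : (N <= M)%N ->
    cell_left a N <= nega_psum R d eps M <= cell_right a N.
  move=> NM; rewrite psE; have /andP[odd0 odd1] := odd_le M.
  apply/andP; split.
    by rewrite (le_trans (cell_left_nondecreasing a NM))// lerDl.
  by rewrite (le_trans _ (cell_right_nonincreasing da NM))// cell_rightE lerD2l.
split=> [[_ cv] N|xin].
  rewrite -(cvg_lim (@Rhausdorff R) cv).
  have cvg_ps : cvgn (nega_psum R d eps) by apply/cvg_ex; exists x.
  apply/andP; split; [apply: limr_ge|apply: limr_le] => //.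
    by exists N => // M /= NM; case/andP: (ps_in M N NM).
  by exists N => // M /= NM; case/andP: (ps_in M N NM).
split=> //; apply/cvgrPdist_le => e e0.
have /cvgrPdist_le/(_ e e0)[N0 _ small] := @inv_denom_cvg0 R d d_gt1.
exists N0 => // N /= N0N; apply: le_trans (small N N0N) => /=.
rewrite sub0r normrN [leRHS]ger0_norm ?invr_ge0// ler_distl.
have := ps_in N N (leqnn N); have := xin N; rewrite cell_rightE.
by move=> /andP[? ?] /andP[? ?]; apply/andP; split; lra.
Qed.

(** The nested cylinders of any digit sequence have a common point, so the
    assumption on points gives convergence along every digit sequence. *)
Lemma exists_point a : digit_seq d a ->
  exists x, 0 <= x <= 1 /\ forall N, cell_left a N <= x <= cell_right a N.
Proof.
move=> da; have ub N : ubound (range (cell_left a)) (cell_right a N).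
  by move=> _ [M _ <-]; exact: cell_left_le_right.
have hs : has_sup (range (cell_left a)).
  by split; [exists (cell_left a 0%N), 0%N|exists (cell_right a 0%N)].
have xin N : cell_left a N <= sup (range (cell_left a)) <= cell_right a N.
  apply/andP; split; first by apply: ub_le_sup; [exact: hs.2|exists N].
  by apply: sup_le_ub; [exact: hs.1|exact: ub].
exists (sup (range (cell_left a))); split=> //.
by have := xin 0%N; rewrite /cell_left /cell_right denom0 divr1 /= divr1.
Qed.

Definition cantor_digit x n : nat :=
  (Num.trunc ((denom d n)%:R * x) %% d n)%N.

Lemma cantor_digit_seq x : digit_seq d (cantor_digit x).
Proof. by move=> n n0; rewrite ltn_pmod// ltnW// d_gt1. Qed.

Lemma cantor_num_digit x N : 0 <= x < 1 ->
  cantor_num d (cantor_digit x) N = Num.trunc ((denom d N)%:R * x).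
Proof.
move=> /andP[x0 x1]; elim: N => [|N IH].
  by rewrite /= denom0 mul1r; apply/esym/truncn_def; rewrite x0 x1.
rewrite cantor_numS IH /cantor_digit.
set K := Num.trunc ((denom d N.+1)%:R * x).
suff -> : Num.trunc ((denom d N)%:R * x) = (K %/ d N.+1)%N by rewrite -divn_eq.
have /truncn_itv/andP[Kl Ku] : 0 <= (denom d N.+1)%:R * x by rewrite mulr_ge0.
have dR : 0 < (d N.+1)%:R :> R by rewrite ltr0n d_gt0.
apply: truncn_def; apply/andP; split.
  rewrite -(ler_pM2r dR) mulrAC -natrM -[X in _ <= X * _]natrM -denomS.
  by apply: le_trans Kl; rewrite ler_nat leq_trunc_div.
rewrite -(ltr_pM2r dR) mulrAC -natrM -[X in _ < X]natrM -denomS.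
by apply: lt_le_trans Ku _; rewrite ler_nat ltn_ceil// d_gt0.
Qed.

Lemma cantor_digit_in x N : 0 <= x < 1 ->
  cell_left (cantor_digit x) N <= x < cell_right (cantor_digit x) N.
Proof.
move=> x01; rewrite /cell_left /cell_right cantor_num_digit//.
rewrite ler_pdivrMr ?denomR_gt0// ltr_pdivlMr ?denomR_gt0// mulrC.
by apply: truncn_itv; rewrite mulr_ge0//; case/andP: x01.
Qed.

Lemma eq_nested a w x : (forall n, (0 < n)%N -> a n = w n) ->
  (forall N, cell_left a N <= x <= cell_right a N) ->
  forall N, cell_left w N <= x <= cell_right w N.
Proof.
move=> aw h N; have e : cantor_num d a N = cantor_num d w N.
  by elim: N {h} => [//|N IH]; rewrite !cantor_numS IH aw.
by have := h N; rewrite /cell_left /cell_right e.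
Qed.

Hypothesis hP : matrix_P d p.
Hypothesis hF : forall x eps, 0 <= x <= 1 -> nega_rep d eps x ->
  cvgn (Ftilde_psum d p eps).

Lemma nega_rep_flip a x : digit_seq d a ->
  (forall N, cell_left a N <= x <= cell_right a N) -> nega_rep d (flip a) x.
Proof.
move=> da xin; apply/nega_repP; first exact: flip_digit_seq.
by apply: eq_nested xin => n n0; rewrite flipK.
Qed.

Lemma digsum_cvg_flip a (l : R) : digit_seq d a ->
  Ftilde_psum d p (flip a) @ \oo --> l <-> digsum (beta p) p a @ \oo --> l.
Proof.
move=> da; rewrite Ftilde_psum_cvg.
suff -> : digsum (beta p) p (flip (flip a)) = digsum (beta p) p a by [].
by apply/funext => N; apply: eq_digsum => j /andP[j0 _]; rewrite flipK.
Qed.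

Lemma digsum_cvg a : digit_seq d a -> cvgn (digsum (beta p) p a).
Proof.
move=> da; have [x [x01 xin]] := exists_point da.
have cv := hF x01 (nega_rep_flip da xin).
by apply/cvg_ex; exists (limn (Ftilde_psum d p (flip a))); apply/digsum_cvg_flip.
Qed.

Lemma digsum_uniformly_bounded :
  exists K, forall a N, digit_seq d a -> `|digsum (beta p) p a N| <= K.
Proof.
have [p_lt1 p_sum _ _] := hP.
have p_le1 n e : (0 < n)%N -> (e < d n)%N -> `|p e n| <= 1.
  move=> n0 ed; rewrite ler_norml.
  by have /andP[/ltW -> /ltW ->] := p_lt1 n e n0 ed.
apply: (@digsum_bounded R d) => //; last exact: digsum_cvg.
move=> n e n0 ed; apply: near_nonzero_digit => // i; exact: p_le1.
Qed.

(** Two representations of [x] label, at each rank, cylinders that are equal or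
    adjacent, and the partial sums then differ at most by the weight of a
    cylinder, which tends to [0]: the value does not depend on the
    representation. *)
Lemma word_sum_cvg x : 0 <= x < 1 ->
  word_sum d p N (Num.trunc ((denom d N)%:R * x)) @[N --> \oo] --> Ftilde d p x.
Proof.
move=> x01; have /andP[x0 x1] := x01.
have x01' : 0 <= x <= 1 by rewrite x0 ltW.
have [_ p_sum p_prod _] := hP.
pose c := cantor_digit x; have dc : digit_seq d c := cantor_digit_seq x.
have [eps rep cv] : [set y | exists2 eps, nega_rep d eps x &
    Ftilde_psum d p eps @ \oo --> y] (Ftilde d p x).
  apply: xgetPex; have rep : nega_rep d (flip c) x.
    apply: nega_rep_flip => // N.
    by have /andP[-> /ltW ->] := cantor_digit_in N x01.
  by exists (limn (Ftilde_psum d p (flip c))), (flip c) => //; exact: hF x01' rep.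
have de := rep.1; set a := flip eps in cv *; have da := flip_digit_seq de.
move/Ftilde_psum_cvg : cv => cv.
have close N : `|word_sum d p N (Num.trunc ((denom d N)%:R * x))
    - digsum (beta p) p a N| <= `|digprod p a N|.
  have [<- <-] := word_cantor_num p d_gt1 N da.
  have := cantor_digit_in N x01; rewrite /cell_left /cell_right cantor_num_digit//.
  have /(nega_repP _ de)/(_ N) := rep; rewrite -/a /cell_left /cell_right.
  rewrite !ler_pdivrMr ?denomR_gt0// ltr_pdivlMr ?denomR_gt0//.
  rewrite ler_pdivlMr ?denomR_gt0//.
  set D := denom d N; set k := Num.trunc _; set k' := cantor_num _ _ _.
  move=> /andP[k'l k'u] /andP[kl ku].
  have k'k : (k' <= k)%N by rewrite -ltnS -(ltr_nat R); exact: le_lt_trans ku.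
  have kk' : (k <= k'.+1)%N by rewrite -(ler_nat R); exact: le_trans k'u.
  have kD : (k < D)%N.
    rewrite -(ltr_nat R); apply: le_lt_trans kl _.
    by rewrite gtr_pMl// denomR_gt0.
  have [->|kE] : k = k' \/ k = k'.+1 by lia.
    by rewrite subrr normr0.
  rewrite kE in kD *; rewrite word_sum_succ//.
  by rewrite addrAC subrr add0r.
have diff0 : (word_sum d p N (Num.trunc ((denom d N)%:R * x))
    - digsum (beta p) p a N) @[N --> \oo] --> 0.
  apply/norm_cvg0P; apply: squeeze_cvgr (cvg_cst 0) (p_prod a da).
  apply: nearW => N; rewrite normr_ge0/= (le_trans (close N))//.
  by rewrite /digprod normr_prod.
exact: cvg_sub0 diff0 cv.
Qed.

End Expansions.

(** * Integration of step functions *)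

Section StepFunctions.
Set Implicit Arguments.
Unset Strict Implicit.
Unset Printing Implicit Defensive.
Variable R : realType.
Local Notation mu := (@lebesgue_measure R).
Implicit Types (D k : nat) (g : nat -> R) (x : R).

Let cell D k : set R := `[k%:R / D%:R, k.+1%:R / D%:R[.

Lemma truncn_cells D g x : (0 < D)%N -> 0 <= x < 1 ->
  g (Num.trunc (D%:R * x)) = \sum_(0 <= k < D) g k * \1_(cell D k) x.
Proof.
move=> D0 /andP[x0 x1]; have DR : 0 < D%:R :> R by rewrite ltr0n.
have Dx0 : 0 <= D%:R * x by rewrite mulr_ge0.
have ind k : \1_(cell D k) x = (Num.trunc (D%:R * x) == k)%:R :> R.
  rewrite indicE; congr (nat_of_bool _)%:R; rewrite truncn_eq//.
  by rewrite mem_setE /= in_itv/= ler_pdivrMr// ltr_pdivlMr// mulrC.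
have tD : (Num.trunc (D%:R * x) < D)%N.
  by rewrite truncn_lt_nat// gtr_pMr.
rewrite big_mkord (bigD1 (Ordinal tD))//= ind eqxx mulr1 big1 ?addr0// => k kt.
rewrite ind; case: eqP => [e|]; last by rewrite mulr0.
by move: kt; rewrite -val_eqE /= e eqxx.
Qed.

Lemma cell_sub D k : (k < D)%N -> cell D k `<=` `[0, 1[.
Proof.
move=> kD; have DR : 0 < D%:R :> R by rewrite ltr0n; exact: leq_ltn_trans kD.
apply: subset_itv; rewrite bnd_simp; first by rewrite divr_ge0.
by rewrite ler_pdivrMr// mul1r ler_nat.
Qed.

Lemma measurable_step D g : (0 < D)%N ->
  measurable_fun (`[0, 1[ : set R) (fun x => g (Num.trunc (D%:R * x))).
Proof.
move=> D0.
apply: (@eq_measurable_fun _ _ _ _ _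
    (fun x => \sum_(0 <= k < D) g k * \1_(cell D k) x)).
  by move=> x; rewrite inE/= in_itv/= => x01; rewrite (truncn_cells g D0 x01).
apply: measurable_sum => k; apply: measurable_funM => //.
by apply: measurable_indic; exact: measurable_itv.
Qed.

Lemma integral_step D g : (0 < D)%N ->
  (\int[mu]_(x in `[0%R, 1%R[) (g (Num.trunc (D%:R * x)))%:E =
    (D%:R^-1 * \sum_(0 <= k < D) g k)%:E)%E.
Proof.
move=> D0; have DR : 0 < D%:R :> R by rewrite ltr0n.
have int_cell k : mu.-integrable `[0, 1[ (EFin \o \1_(cell D k)).
  apply: measurable_bounded_integrable => //.
  - by rewrite /= lebesgue_measure_itv/= lte_fin ltr01 sube0 ltry.
  - by apply: measurable_indic; exact: measurable_itv.
  exists 1; split=> // M M1 x _ /=; rewrite indicE.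
  by apply: le_trans (ltW M1); case: (_ \in _); rewrite ?normr1 ?normr0.
transitivity (\int[mu]_(x in `[0%R, 1%R[) \sum_(0 <= k < D)
    ((g k)%:E * (\1_(cell D k) x)%:E))%E.
  apply: eq_integral => x; rewrite inE/= in_itv/= => x01.
  rewrite (truncn_cells g D0 x01) -sumEFin.
  by apply: eq_bigr => k _; rewrite EFinM.
rewrite integral_sum//; last by move=> k; apply: integrableZl => //; exact: int_cell.
rewrite mulr_sumr -sumEFin; apply: eq_big_nat => k /andP[_ kD].
rewrite integralZl//; last exact: int_cell.
rewrite integral_indic//; last exact: measurable_itv.
rewrite setIidl; last exact: cell_sub.
rewrite /cell /= lebesgue_measure_itv/= lte_fin ltr_pM2r ?invr_gt0// ltr_nat ltnSn.
by rewrite -EFinB -mulrBl -natrB// subSnn mul1r -EFinM mulrC.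
Qed.

End StepFunctions.

Section AddEndpoint.
Set Implicit Arguments.
Unset Strict Implicit.
Unset Printing Implicit Defensive.

Lemma integrable_itv_bndo_bndc (R : realType) (a : itv_bound R) (r : R)
    (f : R -> R) :
  (@lebesgue_measure R).-integrable [set` Interval a (BLeft r)] (EFin \o f) ->
  (@lebesgue_measure R).-integrable [set` Interval a (BRight r)] (EFin \o f).
Proof.
move=> /integrableP[/measurable_EFinP mf foo]; apply/integrableP; split.
  by apply/measurable_EFinP/measurable_fun_itv_bndo_bndcP.
rewrite -integral_itv_bndo_bndc//.
by apply: measurableT_comp => //; exact/measurable_EFinP.
Qed.

End AddEndpoint.

(** * The integral *)

(* [hF] says that the series defining the function converges at every point,
   i.e. that the function is defined on the whole of [0, 1]. *)
Theorem mainTheorem3 (R : realType) (d : nat -> nat) (p : nat -> nat -> R)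
    (hd : forall n, (0 < n)%N -> (1 < d n)%N)
    (hP : matrix_P d p)
    (hF : forall (x : R) (eps : nat -> nat), 0 <= x <= 1 -> nega_rep d eps x ->
          cvgn (Ftilde_psum d p eps)) :
  (@lebesgue_measure R).-integrable `[0, 1] (EFin \o Ftilde d p) /\
  (\sum_(1 <= n < N.+1)
      (\sum_(0 <= e < d n) tbeta d p e n) / (\prod_(1 <= j < n.+1) d j)%:R)
    @[N --> \oo] --> \int[@lebesgue_measure R]_(x in `[0, 1]) Ftilde d p x.
Proof.
(* The steps are half-open intervals, so the limit is taken without the right end
   of the unit interval, which has measure zero and is added afterwards. *)
pose f N (x : R) := word_sum d p N (Num.trunc ((denom d N)%:R * x)).
have mf N : measurable_fun (`[0, 1[ : set R) (f N).
  exact: (measurable_step (word_sum d p N) (denom_gt0 hd N)).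
have f_cvg (x : R) : `[0, 1[%classic x -> f N x @[N --> \oo] --> Ftilde d p x.
  by rewrite /= in_itv/= => x01; exact: word_sum_cvg.
have mF : measurable_fun (`[0, 1[ : set R) (Ftilde d p).
  by exact: measurable_fun_cvg f_cvg.
have [K boundK] := digsum_uniformly_bounded hd hP hF.
have f_le N (x : R) : `[0, 1[%classic x -> `|f N x| <= K.
  rewrite /= in_itv/= => x01; rewrite /f -(cantor_num_digit hd N x01).
  have dx := cantor_digit_seq hd x.
  by rewrite (word_cantor_num p hd N dx).2 boundK.
have mu_fin : (@lebesgue_measure R `[0%R, 1%R[ < +oo)%E.
  by rewrite lebesgue_measure_itv/= lte_fin ltr01 sube0 ltry.
have intK : (@lebesgue_measure R).-integrable `[0, 1[ (EFin \o cst K).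
  apply: measurable_bounded_integrable => //.
  by exists `|K|; split=> [|M KM x _ /=]; [exact: num_real|exact: ltW].
have [] := @dominated_convergence _ _ _ (@lebesgue_measure R) `[0, 1[
    (measurable_itv _) (fun N => EFin \o f N) (EFin \o Ftilde d p) (EFin \o cst K).
- by move=> N; apply: measurableT_comp (mf N).
- exact: measurableT_comp mF.
- apply: aeW => x x01; apply: cvg_comp (f_cvg x x01) _; exact: cvg_refl.
- exact: intK.
- by apply: aeW => x N x01; rewrite /= lee_fin f_le.
move=> intF _ lim_int; split; first exact: integrable_itv_bndo_bndc.
rewrite -Rintegral_itv_bndo_bndc//.
have [_ p_sum1 _ _] := hP.
have int_f N : (\int[@lebesgue_measure R]_(x in `[0%R, 1%R[) (f N x)%:E)%E =
    (\sum_(1 <= n < N.+1)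
      (\sum_(0 <= e < d n) tbeta d p e n) / (\prod_(1 <= j < n.+1) d j)%:R)%:E.
  rewrite (integral_step (word_sum d p N) (denom_gt0 hd N)).
  by rewrite mean_word_sum.
suff /fine_cvg : (\int[@lebesgue_measure R]_(x in `[0%R, 1%R[) (f N x)%:E)%E
    @[N --> \oo] --> (\int[@lebesgue_measure R]_(x in `[0, 1[) Ftilde d p x)%:E.
  by under eq_fun do rewrite /= int_f.
by rewrite /Rintegral fineK//; exact: integrable_fin_num.
Qed.
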